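(* Let $n \geq 2$ and $G = F_{n,\infty}$. Let $\mathcal{A}$ be the set of all subgroups of finite index in $G$. Then $\sup_{H \in \mathcal{A}} d(H) < \infty$.
   Context: For $n \geq 2$, the generalised Thompson group is $F_{n,\infty} = \langle x_0, x_1, \ldots, x_m, \ldots \mid x_i^{x_j} = x_{i+n-1} \text{ for } i > j \geq 0 \rangle$, where $x^y = y^{-1}xy$. For a finitely generated group $H$, $d(H)$ denotes the minimal number of generators of $H$. *)

(* Defs.v *)
(* The generalised Thompson group F_{n,oo} is built concretely
   as the group given by its presentation: words in the letters x_i^{+-1}
   (i : nat) modulo the congruence generated by free cancellation and the
   defining relators x_j^{-1} x_i x_j x_{i+n-1}^{-1} (i > j >= 0). *)
From Stdlib Require Import List Arith Relations.
Import ListNotations.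

(* a letter (i, false) is x_i, (i, true) is x_i^{-1} *)
Definition letter := (nat * bool)%type.
Definition word := list letter.

Definition linv (a : letter) : letter := (fst a, negb (snd a)).
Definition winv (w : word) : word := rev (map linv w).

(* relator for x_i^{x_j} = x_{i+n-1}, i.e. x_j^{-1} x_i x_j x_{i+n-1}^{-1} *)
Definition relator (n i j : nat) : word :=
  [(j, true); (i, false); (j, false); (i + n - 1, true)].

Inductive step (n : nat) : word -> word -> Prop :=
| step_cancel : forall u v a, step n (u ++ a :: linv a :: v) (u ++ v)
| step_rel : forall u v i j, j < i -> step n (u ++ relator n i j ++ v) (u ++ v).

Definition weq (n : nat) : word -> word -> Prop := clos_refl_sym_trans word (step n).

Definition is_subgroup (n : nat) (H : word -> Prop) : Prop :=
  (forall u v, weq n u v -> H u -> H v) /\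
  H [] /\
  (forall u v, H u -> H v -> H (u ++ v)) /\
  (forall u, H u -> H (winv u)).

Definition finite_index (n : nat) (H : word -> Prop) : Prop :=
  exists reps : list word, forall g : word, exists r, In r reps /\ H (winv r ++ g).

Inductive generated (n : nat) (gens : list word) : word -> Prop :=
| gen_base : forall g, In g gens -> generated n gens g
| gen_nil : generated n gens []
| gen_app : forall u v, generated n gens u -> generated n gens v -> generated n gens (u ++ v)
| gen_inv : forall u, generated n gens u -> generated n gens (winv u)
| gen_weq : forall u v, weq n u v -> generated n gens u -> generated n gens v.

Definition generates (n : nat) (gens : list word) (H : word -> Prop) : Prop :=
  forall w, H w <-> generated n gens w.

Definition rank_le (n : nat) (H : word -> Prop) (k : nat) : Prop :=
  exists gens : list word, length gens <= k /\ generates n gens H.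

(* Main.v *)
(* Write n = d + 1 and a_i = x_i x_{i+d}^{-1} for i >= 1.  If H has finite index, its normal
   core N contains all m-th powers for some m > 0.  Conjugation by x_0^m shows that x_i and
   x_{i+md} agree modulo N, and then the relations force a_i into N, hence into H.

   Let L <= H be generated by x_0^m, ..., x_d^m, a_1, ..., a_{d+1} and
   y = x_1 x_{1+(m+3)d}^{-1}.  As a_i commutes with x_k for k > i + d, conjugation by y maps
   a_i to a_{i+d} for small i >= 2; together with conjugation by x_0^m this puts every a_i
   in L.  So, modulo L, the first letter of x_k w x_k^{-1} can be traded for x_j with j large,
   where the relations apply; this makes L normal with abelian quotient generated by
   x_0, ..., x_d.  Therefore H is generated by L and d + 1 further elements, and the number
   of generators does not depend on m. *)
Require Import Defs.
From Stdlib Require Import List Arith Lia Relations Morphisms Setoid Classical.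
Import ListNotations.

(** * Group laws for words modulo [weq] *)

Lemma winv_app (u v : word) : winv (u ++ v) = winv v ++ winv u.
Proof. unfold winv. now rewrite map_app, rev_app_distr. Qed.

Lemma linv_involutive (a : letter) : linv (linv a) = a.
Proof. destruct a as [i b]; unfold linv; simpl. now rewrite Bool.negb_involutive. Qed.

Lemma winv_involutive (u : word) : winv (winv u) = u.
Proof.
  unfold winv. rewrite map_rev, rev_involutive, map_map.
  rewrite (map_ext _ (fun a => a)), map_id; auto using linv_involutive.
Qed.

#[export] Instance weq_equivalence (n : nat) : Equivalence (weq n).
Proof.
  split; [intros u | intros u v | intros u v w]; unfold weq;
    eauto using rst_refl, rst_sym, rst_trans.
Qed.

Lemma weq_app_l (n : nat) (p u v : word) : weq n u v -> weq n (p ++ u) (p ++ v).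
Proof.
  induction 1 as [u v st | u | u v _ IH | u v w _ IH1 _ IH2].
  - apply rst_step. destruct st as [u v a | u v i j ij].
    + rewrite !app_assoc. constructor.
    + rewrite !(app_assoc p). now constructor.
  - reflexivity.
  - now symmetry.
  - now transitivity (p ++ v).
Qed.

Lemma weq_app_r (n : nat) (p u v : word) : weq n u v -> weq n (u ++ p) (v ++ p).
Proof.
  induction 1 as [u v st | u | u v _ IH | u v w _ IH1 _ IH2].
  - apply rst_step. destruct st as [u v a | u v i j ij].
    + rewrite <- !app_assoc. simpl. constructor.
    + rewrite <- !app_assoc. now constructor.
  - reflexivity.
  - now symmetry.
  - now transitivity (v ++ p).
Qed.

#[export] Instance weq_app (n : nat) : Proper (weq n ==> weq n ==> weq n) (@app letter).
Proof.
  intros u u' Hu v v' Hv. transitivity (u ++ v').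
  - now apply weq_app_l.
  - now apply weq_app_r.
Qed.

Lemma weq_mulKV (n : nat) (u v : word) : weq n (u ++ winv u ++ v) v.
Proof.
  revert v; induction u as [|a u IH]; intros v; [reflexivity|].
  change (a :: u) with ([a] ++ u). rewrite winv_app, <- !app_assoc, IH.
  apply rst_step, (step_cancel n [] v a).
Qed.

Lemma weq_mulVK (n : nat) (u v : word) : weq n (winv u ++ u ++ v) v.
Proof. rewrite <- (winv_involutive u) at 2. apply weq_mulKV. Qed.

Lemma weq_mulV (n : nat) (u : word) : weq n (u ++ winv u) [].
Proof. rewrite <- (app_nil_r (winv u)). apply weq_mulKV. Qed.

Lemma weq_Vmul (n : nat) (u : word) : weq n (winv u ++ u) [].
Proof. rewrite <- (app_nil_r u) at 2. apply weq_mulVK. Qed.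

#[export] Instance weq_winv (n : nat) : Proper (weq n ==> weq n) winv.
Proof.
  intros u v uv.
  transitivity (winv v ++ v ++ winv u); [symmetry; apply weq_mulVK|].
  transitivity (winv v ++ u ++ winv u); [now apply weq_app_l, weq_app_r; symmetry|].
  now rewrite weq_mulV, app_nil_r.
Qed.

Ltac group_simpl :=
  repeat (rewrite <- app_assoc || rewrite winv_app || rewrite winv_involutive
          || rewrite app_nil_r);
  repeat (rewrite weq_mulKV || rewrite weq_mulVK || rewrite weq_mulV
          || rewrite weq_Vmul || rewrite app_nil_r || rewrite app_nil_l).

Ltac group := group_simpl; try reflexivity.

(** * Powers, subgroups and generation *)

Fixpoint pow (w : word) (k : nat) : word :=
  match k with 0 => [] | S k => w ++ pow w k end.

Lemma pow_add (w : word) (i j : nat) : pow w (i + j) = pow w i ++ pow w j.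
Proof. induction i as [|i IH]; simpl; [|rewrite IH, app_assoc]; auto. Qed.

Lemma pow_succ_r (w : word) (k : nat) : pow w (S k) = pow w k ++ w.
Proof. rewrite <- Nat.add_1_r, pow_add. simpl. now rewrite app_nil_r. Qed.

Lemma pow_mul (w : word) (i j : nat) : pow w (i * j) = pow (pow w i) j.
Proof.
  induction j as [|j IH]; [now rewrite Nat.mul_0_r|].
  now rewrite Nat.mul_succ_r, Nat.add_comm, pow_add, IH.
Qed.

Section Subgroup.
Context (n : nat) (S : word -> Prop) (HS : is_subgroup n S).

Lemma subgroup_weq (u v : word) : weq n u v -> S u -> S v.
Proof. apply HS. Qed.

Lemma subgroup_nil : S [].
Proof. apply HS. Qed.

Lemma subgroup_app (u v : word) : S u -> S v -> S (u ++ v).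
Proof. apply HS. Qed.

Lemma subgroup_winv (u : word) : S u -> S (winv u).
Proof. apply HS. Qed.

Lemma subgroup_pow (u : word) (k : nat) : S u -> S (pow u k).
Proof. intros Su; induction k; simpl; auto using subgroup_nil, subgroup_app. Qed.

Lemma generated_subgroup (gens : list word) (w : word) :
  (forall g, In g gens -> S g) -> generated n gens w -> S w.
Proof.
  intros Sg; induction 1; eauto using subgroup_nil, subgroup_app, subgroup_winv, subgroup_weq.
Qed.

End Subgroup.

Lemma generated_is_subgroup (n : nat) (gens : list word) : is_subgroup n (generated n gens).
Proof.
  repeat split; [intros u v; apply gen_weq | apply gen_nil | apply gen_app | apply gen_inv].
Qed.

Lemma generated_conj (n : nat) (gens : list word) (g w : word) :
  (forall s, In s gens -> generated n gens (g ++ s ++ winv g)) ->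
  generated n gens w -> generated n gens (g ++ w ++ winv g).
Proof.
  intros Hg; induction 1 as [s Hs | | u v _ IHu _ IHv | u _ IH | u v uv _ IH].
  - auto.
  - apply (gen_weq _ _ []); [group | apply gen_nil].
  - apply (gen_weq _ _ ((g ++ u ++ winv g) ++ (g ++ v ++ winv g))); [group | now apply gen_app].
  - apply (gen_weq _ _ (winv (g ++ u ++ winv g))); [group | now apply gen_inv].
  - apply (gen_weq _ _ (g ++ u ++ winv g)); [now rewrite uv | auto].
Qed.

Lemma conj_pow (n : nat) (g u : word) (k : nat) :
  weq n (pow (winv g ++ u ++ g) k) (winv g ++ pow u k ++ g).
Proof. induction k as [|k IH]; simpl; [group|]. rewrite IH. group. Qed.

(** * Adjoining one element to a subgroup that contains all commutators *)

Section AbelianQuotient.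
Context (n : nat) (T : word -> Prop) (HT : is_subgroup n T).
Context (Tcomm : forall u v, T (u ++ v ++ winv u ++ winv v)).

(** Multiply on the left by the commutator of [b] and [a]. The variants below let factors be
    permuted freely inside [T]. *)
Lemma derived_swap (a b c : word) : T (a ++ b ++ c) -> T (b ++ a ++ c).
Proof.
  intros Tabc.
  apply (subgroup_weq n T HT ((b ++ a ++ winv b ++ winv a) ++ (a ++ b ++ c))); [group|].
  now apply (subgroup_app n).
Qed.

Lemma derived_comm (a b : word) : T (a ++ b) -> T (b ++ a).
Proof.
  intros Tab. rewrite <- (app_nil_r a). apply derived_swap. now rewrite app_nil_r.
Qed.

Lemma derived_conj (g w : word) : T w -> T (g ++ w ++ winv g).
Proof.
  intros Tw. rewrite app_assoc. apply derived_comm.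
  now apply (subgroup_weq n T HT w); [symmetry; group|].
Qed.

Lemma derived_swap_mid (a b c e : word) : T (a ++ b ++ c ++ e) -> T (a ++ c ++ b ++ e).
Proof.
  intros Tabce.
  apply (subgroup_weq n T HT
           ((a ++ (c ++ b ++ winv c ++ winv b) ++ winv a) ++ (a ++ b ++ c ++ e))); [group|].
  now apply (subgroup_app n); [|apply derived_conj|].
Qed.

Lemma derived_swap_end (a b c : word) : T (a ++ b ++ c) -> T (a ++ c ++ b).
Proof.
  intros Tabc. rewrite <- (app_nil_r b). apply derived_swap_mid. now rewrite app_nil_r.
Qed.

Context (x : word) (m : nat) (m_pos : 0 < m) (Txm : T (pow x m)).

(* The subgroup generated by [T] and [x]: as [x ^ m] lies in [T], nonnegative exponents suffice. *)
Definition adjoin (w : word) : Prop := exists e, T (w ++ pow x e).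

Lemma adjoin_incl (w : word) : T w -> adjoin w.
Proof. exists 0. simpl. now rewrite app_nil_r. Qed.

Lemma adjoin_base : adjoin x.
Proof.
  exists (m - 1). change (T (pow x (S (m - 1)))). now replace (S (m - 1)) with m by lia.
Qed.

Lemma adjoin_is_subgroup : is_subgroup n adjoin.
Proof.
  split; [|split; [|split]].
  - intros u v uv [e Te]. exists e. apply (subgroup_weq n T HT (u ++ pow x e)); [|easy].
    now rewrite uv.
  - apply adjoin_incl, (subgroup_nil n T HT).
  - intros u v [e Te] [f Tf]. exists (e + f). rewrite pow_add.
    assert (Tuv : T ((u ++ pow x e) ++ (v ++ pow x f))) by now apply (subgroup_app n).
    rewrite <- !app_assoc in *. now apply derived_swap_mid.
  (* Modulo [T], [(m - 1) * e] acts as the exponent [- e], since [x ^ (m * e)] lies in [T]. *)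
  - intros u [e Te]. exists ((m - 1) * e).
    apply (subgroup_weq n T HT (winv u ++ winv (pow x e) ++ pow x e ++ pow x ((m - 1) * e)));
      [group|].
    apply derived_swap. rewrite <- pow_add.
    replace (e + (m - 1) * e) with (m * e) by nia.
    rewrite app_assoc, <- winv_app.
    apply (subgroup_app n); [easy | now apply (subgroup_winv n) |].
    rewrite pow_mul. now apply (subgroup_pow n).
Qed.

(* A generator of the image of [H] in the cyclic group [adjoin / T] supplies the extra element. *)
Lemma rank_adjoin (H : word -> Prop) (k : nat) :
  is_subgroup n H -> rank_le n (fun w => H w /\ T w) k ->
  rank_le n (fun w => H w /\ adjoin w) (S k).
Proof.
  intros HH [gens [len Hgens]].
  (* The positive exponents realised by [H]; the least one, [e0], comes with the extra generator
     [h0]. *)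
  set (P e := 0 < e /\ exists h, H h /\ T (h ++ pow x e)).
  assert (Pm : P m) by (split; [easy|]; exists []; split; [apply HH | easy]).
  destruct (dec_inh_nat_subset_has_unique_least_element P (fun e => classic (P e))
              (ex_intro _ m Pm)) as [e0 [[[e0_pos [h0 [Hh0 Th0]]] least] _]].
  exists (h0 :: gens). split; [simpl; lia|].
  assert (mono : forall w, generated n gens w -> generated n (h0 :: gens) w).
  { intros w. apply generated_subgroup; [apply generated_is_subgroup|].
    intros g Hg. apply gen_base. now right. }
  intros w; split.
  - intros [Hw [e Te]]. revert w Hw Te.
    (* Euclidean division by repeated subtraction: right multiplication by the inverse of [h0]
       lowers [e] by [e0], until [w] lies in [T]. *)
    induction e as [e IH] using lt_wf_ind; intros w Hw Te.
    destruct (Nat.eq_dec e 0) as [->|e_pos].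
    { apply mono, Hgens. simpl in Te. rewrite app_nil_r in Te. now split. }
    assert (e0_le : e0 <= e) by (apply least; split; [lia|]; now exists w).
    apply (gen_weq _ _ ((w ++ winv h0) ++ h0)); [group|].
    apply gen_app; [|apply gen_base; now left].
    apply (IH (e - e0)); [lia | |].
    + apply HH; [easy | now apply HH].
    + replace e with (e - e0 + e0) in Te by lia. rewrite pow_add in Te.
      rewrite <- app_assoc. apply derived_swap_end.
      apply (subgroup_weq n T HT
               ((w ++ pow x (e - e0) ++ pow x e0) ++ winv (h0 ++ pow x e0))); [group|].
      now apply (subgroup_app n); [|apply Te|apply (subgroup_winv n)].
  - intros Gw.
    assert (Ggen : forall g, In g (h0 :: gens) -> H g /\ adjoin g).
    { intros g [<-|Hg].
      - split; [easy|]. now exists e0.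
      - apply (gen_base n), Hgens in Hg. split; [easy|]. now apply adjoin_incl. }
    split.
    + eapply generated_subgroup; eauto. apply Ggen.
    + eapply generated_subgroup; eauto using adjoin_is_subgroup. apply Ggen.
Qed.

End AbelianQuotient.

(** * Finite index and a uniform exponent *)

Lemma pigeonhole (A : Type) (P : nat -> A -> Prop) (l : list A) :
  (forall i, exists a, In a l /\ P i a) ->
  exists i j a, i < j <= length l /\ P i a /\ P j a.
Proof.
  intros HP.
  (* [s] records one choice of witness for each index below [k]; at length [S (length l)] it must
     repeat an entry. *)
  assert (build : forall k, exists s, length s = k /\ incl s l /\
            forall i a, nth_error s i = Some a -> P i a).
  { induction k as [|k [s [len [sl Ps]]]].
    - exists []. repeat split; [intros a [] |]. intros [|i] a; discriminate.
    - destruct (HP k) as [a [al Pa]]. exists (s ++ [a]). repeat split.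
      + rewrite length_app. simpl. lia.
      + apply incl_app; [easy|]. intros b [<-|[]]. easy.
      + intros i b. destruct (Nat.lt_ge_cases i k) as [ik|ik].
        * rewrite nth_error_app1 by lia. apply Ps.
        * rewrite nth_error_app2 by lia. intros E.
          destruct (i - length s) as [|[|j]] eqn:D; simpl in E; try discriminate.
          injection E as <-. now replace i with k by lia. }
  destruct (build (S (length l))) as [s [len [sl Ps]]].
  assert (dup : ~ NoDup s) by (intros nd; apply (NoDup_incl_length nd) in sl; lia).
  rewrite NoDup_nth_error in dup.
  apply not_all_ex_not in dup as [i dup]. apply not_all_ex_not in dup as [j dup].
  apply imply_to_and in dup as [il dup]. apply imply_to_and in dup as [E ij].
  destruct (nth_error s i) as [a|] eqn:Ei.
  2: { apply nth_error_None in Ei. lia. }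
  symmetry in E. assert (jl : j < length s) by (apply nth_error_Some; congruence).
  destruct (Nat.lt_ge_cases i j).
  - exists i, j, a. repeat split; auto; lia.
  - exists j, i, a. repeat split; auto; lia.
Qed.

(** Two of the words [pow g i ++ v] share a coset, so some exponent up to the number of
    representatives works for [g] and [v]. The factorial is a multiple of all such exponents;
    allowing every [v] puts the power in the normal core. *)
Lemma finite_index_exponent (n : nat) (H : word -> Prop) :
  is_subgroup n H -> finite_index n H ->
  exists m, 0 < m /\ forall g v, H (winv v ++ pow g m ++ v).
Proof.
  intros HH [reps Hreps]. exists (fact (length reps)). split; [apply lt_O_fact|].
  intros g v.
  destruct (pigeonhole _ (fun i r => H (winv r ++ pow g i ++ v)) reps
              (fun i => Hreps (pow g i ++ v))) as [i [j [r [ij [Hi Hj]]]]].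
  assert (Hk : H (winv v ++ pow g (j - i) ++ v)).
  { apply (subgroup_weq n H HH (winv (winv r ++ pow g i ++ v) ++ (winv r ++ pow g j ++ v))).
    - replace j with (i + (j - i)) at 1 by lia. rewrite pow_add. group.
    - apply (subgroup_app n); [easy | now apply (subgroup_winv n) | easy]. }
  assert (exists q, fact (length reps) = (j - i) * q) as [q ->].
  { assert (0 < j - i <= length reps) as [pos le] by lia.
    clear - pos le. generalize dependent (j - i). intros k pos le.
    induction le as [|l le [q IH]].
    - destruct k as [|k]; [lia|]. now exists (fact k).
    - exists ((S l) * q). change (fact (S l)) with (S l * fact l). rewrite IH. lia. }
  rewrite pow_mul.
  apply (subgroup_weq n H HH _ _ (conj_pow n v (pow g (j - i)) q)).
  now apply (subgroup_pow n).
Qed.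

Lemma pow_winv (w : word) (k : nat) : pow (winv w) k = winv (pow w k).
Proof.
  induction k as [|k IH]; [reflexivity|]. now rewrite pow_succ_r, IH, <- winv_app.
Qed.

(** * Consequences of the defining relations *)

(** Both [p] and [q] conjugate [a] to the same [b], so their quotient centralises [a]. *)
Lemma commute_quotient (n : nat) (p q a b : word) :
  weq n (a ++ p) (p ++ b) -> weq n (a ++ q) (q ++ b) ->
  weq n (a ++ p ++ winv q) ((p ++ winv q) ++ a).
Proof.
  intros ap aq. rewrite app_assoc, ap.
  assert (E : weq n a (q ++ b ++ winv q)) by (rewrite app_assoc, <- aq; group).
  rewrite E. group.
Qed.

Definition gen (i : nat) : word := [(i, false)].
(** The element $a_i$ is [gdiff i (i + d)], and $y$ is [gdiff 1 (1 + (m + 3) * d)]. *)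
Definition gdiff (i j : nat) : word := gen i ++ winv (gen j).

Section Relations.
Context (d : nat).

Lemma gen_rel (i j : nat) :
  j < i -> weq (S d) (gen i ++ gen j) (gen j ++ gen (i + d)).
Proof.
  intros ji.
  assert (R : weq (S d) (winv (gen j) ++ gen i ++ gen j ++ winv (gen (i + d))) []).
  { replace (i + d) with (i + S d - 1) by lia. apply rst_step.
    exact (step_rel (S d) [] [] i j ji). }
  transitivity (gen j ++ (winv (gen j) ++ gen i ++ gen j ++ winv (gen (i + d))) ++ gen (i + d)).
  - symmetry. group.
  - rewrite R. reflexivity.
Qed.

Lemma gen_pow_rel (i j k : nat) :
  j < i -> weq (S d) (gen i ++ pow (gen j) k) (pow (gen j) k ++ gen (i + k * d)).
Proof.
  revert i; induction k as [|k IH]; intros i ji; cbn [pow Nat.mul].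
  - rewrite Nat.add_0_r, app_nil_r. reflexivity.
  - rewrite app_assoc, (gen_rel i j ji), <- app_assoc, (IH (i + d)) by lia.
    now rewrite Nat.add_assoc, app_assoc.
Qed.

Lemma pow_gen_rel (i j k : nat) :
  j < i -> weq (S d) (pow (gen i) k ++ gen j) (gen j ++ pow (gen (i + d)) k).
Proof.
  intros ji; induction k as [|k IH]; cbn [pow Nat.mul]; [now rewrite app_nil_r|].
  rewrite <- app_assoc, IH, app_assoc, (gen_rel i j ji). now rewrite <- app_assoc.
Qed.

Lemma gdiff_conj (i j k l : nat) :
  j < i -> j < l ->
  weq (S d) (winv (pow (gen j) k) ++ gdiff i l ++ pow (gen j) k)
            (gdiff (i + k * d) (l + k * d)).
Proof.
  intros ji jl. unfold gdiff.
  assert (E : forall t, j < t ->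
            weq (S d) (gen t) (pow (gen j) k ++ gen (t + k * d) ++ winv (pow (gen j) k))).
  { intros t jt. rewrite app_assoc, <- (gen_pow_rel t j k jt). group. }
  rewrite (E i ji), (E l jl). group.
Qed.

Lemma gdiff_commute (i j l : nat) :
  i < l -> j < l -> weq (S d) (gen l ++ gdiff i j) (gdiff i j ++ gen l).
Proof. intros il jl. now apply commute_quotient with (gen (l + d)); apply gen_rel. Qed.

(** * Subgroups containing every $a_i$ *)

Section SubgroupWithDiff.
Context (K : word -> Prop) (HK : is_subgroup (S d) K).
Context (Kdiff : forall i, 0 < i -> K (gdiff i (i + d))).

(** The product $a_i a_{i+d} \cdots a_{i+(k-1)d}$ telescopes. *)
Lemma subgroup_gdiff (i k : nat) : 0 < i -> K (gdiff i (i + k * d)).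
Proof.
  intros i_pos; induction k as [|k IH].
  - apply (subgroup_weq _ K HK []); [|apply HK].
    rewrite Nat.add_0_r. unfold gdiff. group.
  - apply (subgroup_weq _ K HK (gdiff i (i + k * d) ++ gdiff (i + k * d) (i + k * d + d))).
    + replace (i + S k * d) with (i + k * d + d) by lia. unfold gdiff. group.
    + apply (subgroup_app (S d)); [easy | easy |]. apply Kdiff. lia.
Qed.

(* Modulo [K] on the left, [gen k] may be traded for [gen j] with [j] as large as wanted. *)
Lemma subgroup_conj_far (k t : nat) (w : word) :
  0 < k -> K (gen (k + t * d) ++ w ++ winv (gen (k + t * d))) ->
  K (gen k ++ w ++ winv (gen k)).
Proof.
  intros k_pos Kw. set (j := k + t * d) in *.
  apply (subgroup_weq _ K HK
           (gdiff k j ++ (gen j ++ w ++ winv (gen j)) ++ winv (gdiff k j)));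
    [unfold gdiff; group|].
  assert (K (gdiff k j)) by now apply subgroup_gdiff.
  do 2 (apply (subgroup_app (S d)); [easy | easy |]). now apply (subgroup_winv (S d)).
Qed.

(** With $u = x_i^k x_{i+d}^{-k}$, the next difference is $x_i u x_i^{-1} a_i$. The conjugating
    $x_i$ can be traded for an $x_j$ that commutes with $u$. *)
Lemma subgroup_pow_diff (i k : nat) :
  0 < d -> 0 < i -> K (pow (gen i) k ++ winv (pow (gen (i + d)) k)).
Proof.
  intros d_pos i_pos; induction k as [|k IH]; [exact (subgroup_nil _ K HK)|].
  set (u := pow (gen i) k ++ winv (pow (gen (i + d)) k)) in *.
  (* This index exceeds both [i] and [i + d], so both powers in [u] shift it by [k * d]. *)
  set (j := i + 2 * d).
  assert (ju : weq (S d) (gen j ++ u) (u ++ gen j)).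
  { apply commute_quotient with (gen (j + k * d)); apply gen_pow_rel; lia. }
  apply (subgroup_weq _ K HK ((gen i ++ (u ++ winv (gen i))) ++ gdiff i (i + d))).
  { unfold u, gdiff. cbn [pow Nat.mul]. group. }
  apply (subgroup_app (S d)); auto.
  apply (subgroup_conj_far i 2); [easy|]. fold j.
  apply (subgroup_weq _ K HK u); [|easy].
  rewrite app_assoc, ju. symmetry. group.
Qed.

End SubgroupWithDiff.

(* If [N] is the normal core of [H], then conjugating by [gen 0 ^ m] gives
   [gen i = gen (i + m d)] modulo [N], so [gen i] and [gen (i + m d)] have the same
   conjugate by [gen i], that is, [gen i = gen (i + m d + d) = gen (i + d)] modulo [N]. *)
Lemma core_gdiff (H : word -> Prop) (m i : nat) :
  is_subgroup (S d) H -> 0 < d -> 0 < m -> (forall g v, H (winv v ++ pow g m ++ v)) ->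
  0 < i -> H (gdiff i (i + d)).
Proof.
  intros HH d_pos m_pos Hm i_pos.
  set (t j := winv (gen j) ++ gen (j + m * d)).
  assert (Ht : forall j v, 0 < j -> H (winv v ++ t j ++ v)).
  { intros j v j_pos.
    apply (subgroup_weq _ H HH
             (winv (winv (gen j ++ v) ++ pow (gen 0) m ++ (gen j ++ v)) ++
              (winv v ++ pow (gen 0) m ++ v))).
    - unfold t.
      assert (E : weq (S d) (gen (j + m * d)) (winv (pow (gen 0) m) ++ gen j ++ pow (gen 0) m)).
      { rewrite (gen_pow_rel j 0 m j_pos). group. }
      rewrite E. group.
    - apply (subgroup_app (S d)); [easy | now apply (subgroup_winv (S d)) | easy]. }
  apply (subgroup_weq _ H HH
           ((winv (winv (gen i)) ++ t (i + d) ++ winv (gen i)) ++ winv (winv [] ++ t i ++ []))).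
  - assert (E : weq (S d) (gen (i + d + m * d)) (winv (gen i) ++ gen (i + m * d) ++ gen i)).
    { replace (i + d + m * d) with (i + m * d + d) by lia.
      rewrite (gen_rel (i + m * d) i) by nia. group. }
    unfold t, gdiff. rewrite E. cbn [pow Nat.mul]. group.
  - apply (subgroup_app (S d)); [easy | apply Ht; lia |].
    apply (subgroup_winv (S d)); [easy|]. now apply Ht.
Qed.

End Relations.

(** * The subgroup $L$ and the elements it contains *)

Section NormalSubgroup.
Context (d m : nat) (d_pos : 0 < d) (m_pos : 0 < m).

(** In order: $y$, the $d+1$ powers, and $a_1, \ldots, a_{d+1}$. The length $2d+3$ does not depend
    on [m]. *)
Definition small_gens : list word :=
  gdiff 1 (1 + (m + 3) * d) ::
  map (fun i => pow (gen i) m) (seq 0 (S d)) ++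
  map (fun i => gdiff i (i + d)) (seq 1 (S d)).

Definition small : word -> Prop := generated (S d) small_gens.

Lemma small_is_subgroup : is_subgroup (S d) small.
Proof. apply generated_is_subgroup. Qed.

Lemma in_small_gens (s : word) :
  In s small_gens <->
  s = gdiff 1 (1 + (m + 3) * d) \/
  (exists i, i <= d /\ s = pow (gen i) m) \/
  (exists i, 0 < i <= S d /\ s = gdiff i (i + d)).
Proof.
  clear d_pos m_pos. unfold small_gens. cbn [In]. rewrite in_app_iff, !in_map_iff.
  split; intros [E | [[i Hi] | [i Hi]]]; auto.
  - right; left. exists i. rewrite in_seq in Hi. intuition (auto; lia).
  - right; right. exists i. rewrite in_seq in Hi. intuition (auto; lia).
  - right; left. exists i. rewrite in_seq. intuition (auto; lia).
  - right; right. exists i. rewrite in_seq. intuition (auto; lia).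
Qed.

(* Conjugation by [gdiff 1 (1 + (m + 3) d)] shifts small indices by [d], and conjugation
   by [gen 0 ^ m] shifts all of them by [m d]. *)
Lemma small_gdiff (i : nat) : 0 < i -> small (gdiff i (i + d)).
Proof.
  induction i as [i IH] using lt_wf_ind; intros i_pos.
  destruct (Nat.le_gt_cases i (S d)) as [id|id].
  { apply gen_base, in_small_gens. right; right. exists i. split; [lia | easy]. }
  destruct (Nat.le_gt_cases i ((m + 2) * d)) as [im|im].
  (* In this range [i + d < j]: the factor $x_1$ of $y$ shifts $a_{i-d}$ to $a_i$, and $x_j$ then
     commutes with $a_i$. *)
  - set (j := 1 + (m + 3) * d). set (y := gdiff 1 j).
    assert (Ly : small y) by (apply gen_base, in_small_gens; now left).
    assert (Lp : small (gdiff (i - d) (i - d + d))) by (apply IH; lia).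
    apply (gen_weq _ _ (winv y ++ gdiff (i - d) (i - d + d) ++ y)).
    + assert (E := gdiff_conj d (i - d) 1 1 (i - d + d) ltac:(lia) ltac:(lia)).
      replace (i - d + 1 * d) with i in E by lia.
      replace (i - d + d + 1 * d) with (i + d) in E by lia.
      cbn [pow] in E. rewrite app_nil_r in E.
      assert (C := gdiff_commute d i (i + d) j ltac:(unfold j; lia) ltac:(unfold j; lia)).
      unfold y. unfold gdiff at 1 3.
      transitivity (gen j ++ (winv (gen 1) ++ gdiff (i - d) (i - d + d) ++ gen 1)
                      ++ winv (gen j)); [group|].
      rewrite E, app_assoc, C. group.
    + apply gen_app; [now apply gen_inv|]. now apply gen_app.
  - set (p := pow (gen 0) m).
    assert (Lp : small p).
    { apply gen_base, in_small_gens. right; left. exists 0. split; [lia | easy]. }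
    assert (La : small (gdiff (i - m * d) (i - m * d + d))) by (apply IH; nia).
    apply (gen_weq _ _ (winv p ++ gdiff (i - m * d) (i - m * d + d) ++ p)).
    + unfold p. rewrite gdiff_conj by nia.
      replace (i - m * d + m * d) with i by nia.
      now replace (i - m * d + d + m * d) with (i + d) by nia.
    + apply gen_app; [now apply gen_inv|]. now apply gen_app.
Qed.

(** Descend by [d] to an index at most [d], using that $x_{i-d}^m x_i^{-m}$ lies in $L$. *)
Lemma small_pow (i : nat) : small (pow (gen i) m).
Proof.
  induction i as [i IH] using lt_wf_ind.
  destruct (Nat.le_gt_cases i d) as [id|id].
  { apply gen_base, in_small_gens. right; left. now exists i. }
  replace i with (i - d + d) by lia.
  apply (gen_weq _ _ (winv (pow (gen (i - d)) m ++ winv (pow (gen (i - d + d)) m)) ++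
                      pow (gen (i - d)) m)); [group|].
  apply gen_app; [apply gen_inv | apply IH; lia].
  apply (subgroup_pow_diff d small small_is_subgroup small_gdiff); lia.
Qed.

(** * Normality of $L$ *)

(** Only the inclusion of $g L g^{-1}$ in $L$, so inverses need their own argument. *)
Definition normalises (g : word) : Prop := forall w, small w -> small (g ++ w ++ winv g).

Lemma normalises_app (g h : word) : normalises g -> normalises h -> normalises (g ++ h).
Proof.
  intros Ng Nh w Lw. apply (gen_weq _ _ (g ++ (h ++ w ++ winv h) ++ winv g)); [group|].
  now apply Ng, Nh.
Qed.

Lemma normalises_nil : normalises [].
Proof. intros w Lw. now rewrite app_nil_r. Qed.

(** Write $g^{-1} = g^{-m} g^{m-1}$: the first factor lies in $L$ and the second is a nonnegative
    power. *)
Lemma normalises_winv (g : word) : small (pow g m) -> normalises g -> normalises (winv g).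
Proof.
  intros Lg Ng w Lw.
  assert (Npow : forall k, normalises (pow g k)).
  { induction k; cbn [pow]; auto using normalises_nil, normalises_app. }
  apply (gen_weq _ _ (winv (pow g m) ++ (pow g (m - 1) ++ w ++ winv (pow g (m - 1)))
                        ++ pow g m)).
  - assert (E : pow g m = pow g (m - 1) ++ g).
    { rewrite <- pow_succ_r. f_equal. lia. }
    rewrite E. group.
  - apply gen_app; [now apply gen_inv|]. apply gen_app; [now apply Npow | easy].
Qed.

(** On each generator of $L$, trade $x_k$ for a later $x_j$: it commutes with $y$ and $a_i$, while
    $x_j x_i^m x_j^{-1} = x_i^m x_{j+md} x_j^{-1}$. *)
Lemma normalises_gen_pos (k : nat) : 0 < k -> normalises (gen k).
Proof.
  intros k_pos w Lw.
  assert (far : forall s, small s ->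
            (exists t, weq (S d) (gen (k + t * d) ++ s) (s ++ gen (k + t * d))) ->
            small (gen k ++ s ++ winv (gen k))).
  { intros s Ls [t E].
    apply (subgroup_conj_far d small small_is_subgroup small_gdiff k t); [easy|].
    apply (gen_weq _ _ s); [|easy]. rewrite app_assoc, E. symmetry. group. }
  apply generated_conj; [|easy]. intros s Hs.
  assert (Ls : small s) by now apply gen_base.
  apply in_small_gens in Hs as [-> | [[i [_ ->]] | [i [_ ->]]]].
  - apply far; [easy|]. exists (m + 4). apply gdiff_commute; nia.
  - set (t := S i).
    apply (subgroup_conj_far d small small_is_subgroup small_gdiff k t); [easy|].
    set (j := k + t * d).
    apply (gen_weq _ _ (pow (gen i) m ++ winv (gdiff j (j + m * d)))).
    + rewrite app_assoc, gen_pow_rel by nia. unfold gdiff. group.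
    + apply gen_app; [easy|]. apply gen_inv.
      apply (subgroup_gdiff d small small_is_subgroup small_gdiff). lia.
  - apply far; [easy|]. exists (i + 2). apply gdiff_commute; nia.
Qed.

(** The trade needs a positive index, so $x_0$ is handled apart. Its inverse comes first because
    $x_0^{-1} w x_0$ shifts positive indices upwards by [d]. *)
Lemma normalises_winv_gen0 : normalises (winv (gen 0)).
Proof.
  intros w Lw. apply generated_conj; [|easy]. clear w Lw.
  intros s Hs. rewrite winv_involutive.
  assert (E : forall i j, 0 < i -> 0 < j ->
            weq (S d) (winv (gen 0) ++ gdiff i j ++ gen 0) (gdiff (i + d) (j + d))).
  { intros i j i_pos j_pos. assert (E := gdiff_conj d i 0 1 j i_pos j_pos).
    cbn [pow] in E. now rewrite !Nat.mul_1_l, app_nil_r in E. }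
  apply in_small_gens in Hs as [-> | [[[|i] [_ ->]] | [i [Hi ->]]]].
  - apply (gen_weq _ _ (gdiff (1 + d) (1 + d + (m + 3) * d))).
    + rewrite E by lia. now replace (1 + (m + 3) * d + d) with (1 + d + (m + 3) * d) by lia.
    + apply (subgroup_gdiff d small small_is_subgroup small_gdiff). lia.
  - apply (gen_weq _ _ (pow (gen 0) m)); [|apply small_pow].
    change (weq (S d) (pow (gen 0) m) (winv (gen 0) ++ (pow (gen 0) m ++ gen 0))).
    rewrite <- pow_succ_r. cbn [pow]. symmetry. group.
  - apply (gen_weq _ _ (pow (gen (S i + d)) m)); [|apply small_pow].
    rewrite (pow_gen_rel d) by lia. symmetry. group.
  - apply (gen_weq _ _ (gdiff (i + d) (i + d + d))); [now rewrite E by lia|].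
    apply small_gdiff. lia.
Qed.

Lemma normalises_word (g : word) : normalises g.
Proof.
  induction g as [|[i b] g IH]; [apply normalises_nil|].
  apply (normalises_app [(i, b)]); [|easy].
  assert (normalises (gen i) /\ normalises (winv (gen i))) as [N1 N2].
  { destruct i as [|i].
    - split; [|apply normalises_winv_gen0].
      rewrite <- (winv_involutive (gen 0)). apply normalises_winv.
      + rewrite pow_winv. apply gen_inv, small_pow.
      + apply normalises_winv_gen0.
    - assert (normalises (gen (S i))) by (apply normalises_gen_pos; lia).
      split; [easy|]. apply normalises_winv; auto using small_pow. }
  now destruct b.
Qed.

(** * The quotient by $L$ is abelian *)

Definition commutes (u v : word) : Prop := small (u ++ v ++ winv u ++ winv v).

Lemma commutes_sym (u v : word) : commutes u v -> commutes v u.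
Proof.
  intros C. apply (gen_weq _ _ (winv (u ++ v ++ winv u ++ winv v))); [group | now apply gen_inv].
Qed.

(** Induction with $[u, av] = [u, a] \cdot a [u, v] a^{-1}$ and the normality of $L$. *)
Lemma commutes_of_letters (u v : word) :
  (forall i, commutes u (gen i)) -> commutes u v.
Proof.
  intros Cgen; induction v as [|[i b] v IH].
  { apply (gen_weq _ _ []); [cbn; symmetry; group | apply gen_nil]. }
  set (a := [(i, b)]).
  assert (Ca : commutes u a).
  { destruct b; [|apply Cgen]. change a with (winv (gen i)).
    apply (gen_weq _ _ (winv (gen i) ++ winv (u ++ gen i ++ winv u ++ winv (gen i))
                          ++ winv (winv (gen i)))); [group|].
    apply normalises_word, gen_inv, Cgen. }
  change ((i, b) :: v) with (a ++ v).
  apply (gen_weq _ _ ((u ++ a ++ winv u ++ winv a) ++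
                      (a ++ (u ++ v ++ winv u ++ winv v) ++ winv a))); [group|].
  apply gen_app; [exact Ca|]. now apply normalises_word.
Qed.

(** For $j < i$ the relation gives $[x_i, x_j] = x_j a_i^{-1} x_j^{-1}$, a conjugate of an element
    of $L$. *)
Lemma small_commutator (u v : word) : commutes u v.
Proof.
  apply commutes_of_letters; intros j. apply commutes_sym, commutes_of_letters; intros i.
  assert (C : forall i j, j < i -> commutes (gen i) (gen j)).
  { clear i j. intros i j ji.
    apply (gen_weq _ _ (gen j ++ winv (gdiff i (i + d)) ++ winv (gen j))).
    - rewrite (app_assoc (gen i)), (gen_rel d i j ji). unfold gdiff. group.
    - apply normalises_word, gen_inv, small_gdiff. lia. }
  destruct (Nat.lt_trichotomy i j) as [ij | [-> | ij]]; auto using commutes_sym.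
  apply (gen_weq _ _ []); [symmetry; group | apply gen_nil].
Qed.

(** * Climbing from $L$ to the whole group *)

(** The subgroup generated by $L$ and $x_0, \ldots, x_{k-1}$; successive quotients are cyclic. *)
Fixpoint tower (k : nat) : word -> Prop :=
  match k with 0 => small | S k => adjoin (tower k) (gen k) end.

Lemma tower_spec (k : nat) :
  is_subgroup (S d) (tower k) /\ (forall w, small w -> tower k w).
Proof.
  induction k as [|k [HT LT]]; cbn [tower].
  - split; [apply small_is_subgroup | easy].
  - split.
    + apply (adjoin_is_subgroup _ _ HT) with m; auto using small_pow.
      intros u v. apply LT, small_commutator.
    + intros w Lw. now apply adjoin_incl, LT.
Qed.

Lemma tower_gen (k i : nat) : i < k -> tower k (gen i).
Proof.
  induction k as [|k IH]; intros ik; [lia|]. cbn [tower].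
  destruct (tower_spec k) as [HT LT].
  destruct (Nat.eq_dec i k) as [->|ne].
  - apply adjoin_base with m; auto using small_pow.
  - apply adjoin_incl, IH. lia.
Qed.

Lemma tower_top (w : word) : tower (S d) w.
Proof.
  destruct (tower_spec (S d)) as [HT LT].
  assert (Tgen : forall i, tower (S d) (gen i)).
  { induction i as [i IH] using lt_wf_ind.
    destruct (Nat.le_gt_cases i d); [apply tower_gen; lia|].
    (* Beyond index [d], $x_i = a_{i-d}^{-1} x_{i-d}$. *)
    apply (subgroup_weq _ _ HT (winv (gdiff (i - d) (i - d + d)) ++ gen (i - d))).
    - replace (i - d + d) with i by lia. unfold gdiff. group.
    - apply (subgroup_app (S d)); [easy | | apply IH; lia].
      apply LT, gen_inv, small_gdiff. lia. }
  induction w as [|[i b] w IH]; [apply (subgroup_nil (S d) _ HT)|].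
  apply (subgroup_app (S d) _ HT [(i, b)]); [|easy].
  destruct b; [|apply Tgen]. now apply (subgroup_winv (S d) _ HT (gen i)).
Qed.

(** Intersect [H] with the tower: the bottom is $L$ itself, and each of the [S d] floors costs at
    most one generator. *)
Lemma rank_over_small (H : word -> Prop) :
  is_subgroup (S d) H -> (forall w, small w -> H w) ->
  rank_le (S d) H (length small_gens + S d).
Proof.
  intros HH LH.
  assert (rank : forall k, rank_le (S d) (fun w => H w /\ tower k w) (length small_gens + k)).
  { induction k as [|k IH].
    - exists small_gens. split; [lia|]. intros w; cbn [tower]; split; [easy|]. auto.
    - destruct (tower_spec k) as [HT LT].
      rewrite Nat.add_succ_r. cbn [tower].
      apply (rank_adjoin _ _ HT) with m; auto using small_pow.
      intros u v. apply LT, small_commutator. }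
  destruct (rank (S d)) as [gens [len Hgens]].
  exists gens. split; [easy|]. intros w. split.
  - intros Hw. apply Hgens. auto using tower_top.
  - intros Gw. now apply Hgens in Gw.
Qed.

End NormalSubgroup.

(* sup_{H of finite index in F_{n,oo}} d(H) < oo *)
Theorem theoremA1 (n : nat) (hn : 2 <= n) :
  exists N : nat, forall H : word -> Prop,
    is_subgroup n H -> finite_index n H -> rank_le n H N.
Proof.
  destruct n as [|d]; [lia|]. assert (d_pos : 0 < d) by lia.
  (* The generators of $L$, plus one for each floor of the tower; fixed before [H] and [m] are
     known. *)
  exists (1 + (S d + S d) + S d). intros H HH Hfin.
  destruct (finite_index_exponent _ _ HH Hfin) as [m [m_pos Hm]].
  assert (Hdiff : forall i, 0 < i -> H (gdiff i (i + d))).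
  { intros i. now apply core_gdiff with m. }
  replace (1 + (S d + S d)) with (length (small_gens d m)).
  - apply rank_over_small; auto. intros w. apply generated_subgroup; [easy|].
    intros s Hs. apply in_small_gens in Hs as [-> | [[i [_ ->]] | [i [Hi ->]]]].
    + apply (subgroup_gdiff d); auto.
    + rewrite <- (app_nil_r (pow _ _)). exact (Hm (gen i) []).
    + apply Hdiff. lia.
  - unfold small_gens. cbn [length]. now rewrite length_app, !length_map, !length_seq.
Qed.
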